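(* Let $n\ge 2$ and let $\mathcal{A}\subseteq\Delta^n$ be (Lebesgue measurable and) permutation invariant. Let $\nu$ be uniformly distributed over $\Delta^n$. Then, for any real random variable $Z$ with iid samples $Z_1,\dots,Z_{n-1}$ and $Z_n := \operatorname{ess\,sup}[Z] < +\infty$, $$\mathbb{P}\left[\sup_{\mu\in\mathcal{A}}\ \sum_{i=1}^n \mu_i Z_i \ \ge\ \mathbb{E}[Z]\right]\ \ge\ \mathbb{P}\left[\nu\in\mathcal{A}+\mathcal{M}^n\right].$$
   Context: Notation: $[k]=\{1,\dots,k\}$. $\Delta^n=\{\mu\in\mathbb{R}^n:\sum_{i=1}^n\mu_i=1,\ \mu_i\ge 0,\ i\in[n]\}$ is the probability simplex. The cone $\mathcal{M}^n\subset\mathbb{R}^n$ is $$\mathcal{M}^n=\Big\{x\in\mathbb{R}^n:\ \sum_{i=1}^k x_i\ge 0\ \ \forall k\in[n-1],\ \ \sum_{i=1}^n x_i=0\Big\}.$$ $A+B=\{a+b: a\in A, b\in B\}$ is the Minkowski sum. A set $\mathcal{A}\subseteq\Delta^n$ is permutation invariant if for every $\mu\in\mathcal{A}$ and every permutation $\pi$ of $[n]$, $(\mu_{\pi(1)},\dots,\mu_{\pi(n)})\in\mathcal{A}$. Measurability and the uniform distribution on $\Delta^n$ are with respect to $(n-1)$-dimensional Lebesgue measure on the hyperplane containing $\Delta^n$ (i.e. $\nu$ is Dirichlet with parameters $(1,\dots,1)$). The samples $Z_1,\dots,Z_{n-1}$ are independent and have the same distribution as $Z$, while $Z_n$ is the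 deterministic constant $\operatorname{ess\,sup}[Z]$. *)

(* Defs.v *)
From HB Require Import structures.
From mathcomp Require Import all_boot all_order all_algebra all_fingroup.
From mathcomp Require Import all_classical all_reals all_analysis.

Set Implicit Arguments.
Unset Strict Implicit.
Unset Printing Implicit Defensive.

Import Order.TTheory GRing.Theory Num.Theory.
Import numFieldNormedType.Exports.

Local Open Scope classical_set_scope.
Local Open Scope ring_scope.

(* (x_0, ..., x_{n-2}) followed by [last] at index n - 1. *)
Definition extend_last (T : Type) (n : nat) (x : 'I_n.-1 -> T) (last : T)
    (i : 'I_n) : T :=
  if insub (val i) is Some j then x j else last.

Definition simplex (R : realType) (n : nat) : set 'rV[R]_n :=
  [set mu : 'rV[R]_n | \sum_i mu 0 i = 1 /\ forall i, 0 <= mu 0 i].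
Arguments simplex : clear implicits.

(* Indices start at 0, so the k-th partial sum ranges over i < k. *)
Definition coneM (R : realType) (n : nat) : set 'rV[R]_n :=
  [set x : 'rV[R]_n | (forall k : nat, (1 <= k)%N -> (k <= n.-1)%N ->
              0 <= \sum_(i < n | (i < k)%N) x 0 i) /\
           \sum_i x 0 i = 0].
Arguments coneM : clear implicits.

Definition minkowski_sum (R : realType) (n : nat) (A B : set 'rV[R]_n) :
    set 'rV[R]_n :=
  [set a + b | a in A & b in B].

Definition permutation_invariant (R : realType) (n : nat) (A : set 'rV[R]_n) :=
  forall (mu : 'rV[R]_n) (s : 'S_n), A mu -> A (\row_i mu 0 (s i)).

Section lebesgue_tuple.
Local Open Scope ereal_scope.
Variable R : realType.
Let mR := measurableTypeR R.

Definition tuple_cons (n : nat) (p : (mR * n.-tuple mR)%type) :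
    n.+1.-tuple mR := [tuple of p.1 :: p.2].

Lemma measurable_tuple_cons n : measurable_fun setT (@tuple_cons n).
Proof.
exact: (measurable_cons (f := fst) (g := snd)).
Qed.

Section step.
Variables (n : nat) (m : {sigma_finite_measure set (n.-tuple mR) -> \bar R}).

Definition lebesgue_step : set (n.+1.-tuple mR) -> \bar R :=
  pushforward (@lebesgue_measure R \x m) (@tuple_cons n).

Let lebesgue_step0 : lebesgue_step set0 = 0.
Proof. by rewrite /lebesgue_step /pushforward preimage_set0 measure0. Qed.

Let lebesgue_step_ge0 A : 0 <= lebesgue_step A.
Proof. exact: (measure_ge0 (@lebesgue_measure R \x m)). Qed.

Let lebesgue_step_sigma_additive : semi_sigma_additive lebesgue_step.
Proof.
move=> F mF tF mUF; rewrite /lebesgue_step /pushforward preimage_bigcup.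
apply: measure_semi_sigma_additive.
- by move=> k; rewrite -[X in measurable X]setTI; exact: measurable_tuple_cons.
- apply/trivIsetP => /= i j _ _ ij; rewrite -preimage_setI.
  by move/trivIsetP : tF => /(_ _ _ _ _ ij) ->//; rewrite preimage_set0.
- rewrite -preimage_bigcup -[X in measurable X]setTI.
  exact: measurable_tuple_cons.
Qed.

HB.instance Definition _ := isMeasure.Build _ _ _ lebesgue_step
  lebesgue_step0 lebesgue_step_ge0 lebesgue_step_sigma_additive.

Let sigma_finite_lebesgue_step : sigma_finite setT lebesgue_step.
Proof.
have /sigma_finiteP[F [TF ndF Foo]] := sigma_finiteT (@lebesgue_measure R).
have /sigma_finiteP[G [TG ndG Goo]] := sigma_finiteT m.
pose u (t : n.+1.-tuple mR) : (mR * n.-tuple mR)%type :=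
  (thead t, [tuple of behead t]).
have mu : measurable_fun setT u.
  apply/measurable_fun_pairP; split => /=.
    exact: (@measurable_tnth _ mR n.+1 ord0).
  exact: measurable_behead.
have uK p : u (tuple_cons p) = p.
  by case: p => a b; rewrite /u theadE; congr pair; exact/val_inj.
have UFG : \bigcup_k (F k `*` G k) = setT.
  rewrite -subTset => -[x y] _.
  have [i _ Fix] : (\bigcup_i F i) x by rewrite -TF.
  have [j _ Gjy] : (\bigcup_i G i) y by rewrite -TG.
  exists (maxn i j) => //; split.
  - by move: x Fix; exact/subsetPset/ndF/leq_maxl.
  - by move: y Gjy; exact/subsetPset/ndG/leq_maxr.
exists (fun k => u @^-1` (F k `*` G k)).
  by rewrite -preimage_bigcup UFG preimage_setT.
move=> k; have [mF Fk] := Foo k; have [mG Gk] := Goo k; split.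
  by rewrite -[_ @^-1` _]setTI; apply: mu => //; exact: measurableX.
rewrite /lebesgue_step /pushforward -comp_preimage.
rewrite (_ : u \o _ = id); last by apply/funext => p /=; rewrite uK.
by rewrite preimage_id product_measure1E// lte_mul_pinfty// ge0_fin_numE.
Qed.

HB.instance Definition _ :=
  Measure_isSigmaFinite.Build _ _ _ lebesgue_step sigma_finite_lebesgue_step.
End step.

(* Lebesgue measure on the Borel sets of R^n, as the n-fold product of the
   one-dimensional one. *)
Fixpoint lebesgue_tuple (n : nat) :
    {sigma_finite_measure set (n.-tuple mR) -> \bar R} :=
  if n is n'.+1 then lebesgue_step (lebesgue_tuple n') else \d_[tuple].

End lebesgue_tuple.

Section uniform_simplex.
Local Open Scope ereal_scope.
Variables (R : realType) (n : nat).
Let mR := measurableTypeR R.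

(* Parametrization of the hyperplane {x | sum_i x_i = 1} by its first n - 1
   coordinates. Being affine and injective, it carries Lebesgue measure on
   R^(n-1) to a constant multiple of the (n-1)-dimensional Lebesgue measure of
   the hyperplane. *)
Definition hyperplane_chart (t : n.-1.-tuple mR) : 'rV[R]_n :=
  \row_i extend_last (tnth t) (1 - \sum_j tnth t j)%R i.

Definition hyperplane_measurable (A : set 'rV[R]_n) :=
  (((lebesgue_tuple R n.-1)^*)%mu.-cara.-measurable)
    (hyperplane_chart @^-1` A).

(* P[nu \in S] for nu uniform on the simplex. The outer measure induced by
   [lebesgue_tuple] agrees with the completed (Lebesgue) measure on Lebesgue
   measurable sets. Completion matters for S = A + [coneM R n]: such a set is
   always Lebesgue measurable, as the cone has nonempty interior in the
   hyperplane of zero-sum vectors, but it need not be Borel. *)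
Definition uniform_simplex (S : set 'rV[R]_n) : \bar R :=
  ((lebesgue_tuple R n.-1)^*)%mu
    (hyperplane_chart @^-1` (S `&` simplex R n)) /
  ((lebesgue_tuple R n.-1)^*)%mu (hyperplane_chart @^-1` (simplex R n)).

End uniform_simplex.

Section iid.
Local Open Scope ereal_scope.
Context (d : measure_display) (T : measurableType d) (R : realType).
Variable P : probability T R.

Definition mutually_independent (I : finType) (X : I -> {RV P >-> R}) :=
  forall (J : {set I}) (B : I -> set R), (forall i, measurable (B i)) ->
    P (\bigcap_(i in [set` J]) (X i @^-1` B i)) =
    \prod_(i in J) P (X i @^-1` B i).

(* Only measurable sets are compared: [distribution] is a total function, with
   unspecified values elsewhere. *)
Definition same_distribution (X Y : {RV P >-> R}) :=
  forall B : set R, measurable B -> distribution P X B = distribution P Y B.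

End iid.

(* Main.v *)
Require Import Defs.
From mathcomp Require Import all_boot all_order all_algebra all_fingroup.
From mathcomp Require Import all_classical all_reals all_analysis ess_sup_inf.
From mathcomp Require Import measurable_realfun ring lra.

Set Implicit Arguments.
Unset Strict Implicit.
Unset Printing Implicit Defensive.

Import Order.TTheory GRing.Theory Num.Theory.
Import numFieldNormedType.Exports.

Local Open Scope classical_set_scope.
Local Open Scope ring_scope.

(** Write [n = N + 1]. Let [Q] be the quantile function of [Z] and [U_1, ...,
U_N] independent uniform variables on the unit interval, so that the samples
are distributed as [Q (U_1), ..., Q (U_N)] ([sample_law]). Sort the uniforms
and put [U_(0) = 0], [U_(N+1) = 1]; the spacings [nu_i = U_(i) - U_(i-1)] are
then uniform on the simplex.

On the [i]-th spacing [Q] is at most [Q (U_(i))], and at most the essential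
supremum on the last one, hence
  [E[Z] = \int_0^1 Q <= \sum_i nu_i Z_(i)], where [Z_(N+1) = ess sup Z].
If moreover [nu = a + m] with [a] in [A] and [m] in the cone, an Abel summation
gives [\sum_i m_i Z_(i) <= 0]: the partial sums of [m] are nonnegative and the
[Z_(i)] increase. So [E[Z] <= \sum_i a_i Z_(i)] ([spacing_bound]), and since [A]
is permutation invariant the right-hand side is at most the supremum for the
unsorted sample. Under this coupling, the event that [nu] lies in [A + M] is
therefore contained in the event that the supremum is at least [E[Z]].

In place of the integral of [Q], the proof takes the expectation of a step
function of [Z] that dominates [Z], for fixed values [z_1 <= ... <= z_(N+1)]:
  [z_(N+1) - \sum_k (z_(k+1) - z_k) 1_{Z <= z_k}] ([expectation_step]).
This involves only the values of the distribution function at the [z_k]. For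
[z_k = Q (u_k)] these are at least [u_k], which in turn is at least the [k]-th
partial sum of [a].

Concerning the measures, the unit cube is covered by the [N!] images of the
chamber of nondecreasing tuples, which overlap in a null set, and a symmetric
set has the same measure in all of them ([symmetric_chamber_le],
[sorted_cube_ge]). The chamber corresponds to the simplex under partial
summation, a unipotent linear map, which preserves Lebesgue measure
([lebesgue_tuple_cumsum]). Up to a null set, the tuples of
spacings in [A + M] form a subset of the Borel set of those spacings whose
sorted sample satisfies the bound, and this bounds their outer measure. *)

(** * Lebesgue measure on tuples: boxes, symmetries and partial sums *)

Section boxes.
Context {R : realType}.
Let mR := measurableTypeR R.

Definition box (N : nat) (B : 'I_N -> set mR) : set (N.-tuple mR) :=
  [set t | forall i, B i (tnth t i)].

Lemma measurable_box N (B : 'I_N -> set mR) :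
  (forall i, measurable (B i)) -> measurable (box B).
Proof.
move=> mB.
rewrite (_ : box B = \bigcap_(i in [set` 'I_N]) (@tnth _ mR ^~ i) @^-1` B i).
  apply: fin_bigcap_measurable; first exact: finite_finset.
  by move=> i _; rewrite -[X in measurable X]setTI; exact: measurable_tnth.
by apply/seteqP; split => [t tB i _|t tB i]; [exact: tB|exact: (tB i)].
Qed.

Lemma boxI N (B C : 'I_N -> set mR) :
  box B `&` box C = box (fun i => B i `&` C i).
Proof.
apply/seteqP; split => [t [tB tC] i|t tBC]; first by split.
by split=> i; have [] := tBC i.
Qed.

Lemma lebesgue_tuple_box N (B : 'I_N -> set mR) :
  (forall i, measurable (B i)) ->
  lebesgue_tuple R N (box B) = (\prod_(i < N) lebesgue_measure (B i))%E.
Proof.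
elim: N B => [|N IH] B mB.
  rewrite big_ord0 /= diracE mem_set//.
  by case.
rewrite big_ord_recl -IH// -product_measure1E//; last exact: measurable_box.
rewrite [LHS]/= /lebesgue_step /pushforward; congr (_ _).
apply/seteqP; split => -[a t] /=.
  move=> H; split; first by have := H ord0; rewrite (tnth_nth a).
  by move=> i; have := H (lift ord0 i); rewrite tnthS.
move=> [aB tB] i; case: (unliftP ord0 i) => [j|] ->.
  by rewrite tnthS; exact: tB.
by rewrite (tnth_nth a).
Qed.

Lemma measurable_tuple_boxes N :
  @measurable _ (N.-tuple mR) =
  <<s [set box B | B in [set B | forall i, measurable (B i)]] >>.
Proof.
apply/seteqP; split; last first.
  apply: smallest_sub; first exact: sigma_algebra_measurable.
  by move=> _ [B mB <-]; exact: measurable_box.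
apply: smallest_sub; first exact: smallest_sigma_algebra.
move=> X; rewrite -bigcup_seq => -[i _ [Y mY <-]].
apply: sub_sigma_algebra.
exists (fun j => if j == i then Y else setT).
  by move=> j /=; case: ifP.
rewrite setTI; apply/seteqP; split => t /=; first by move/(_ i); rewrite eqxx.
by move=> tY j; case: eqP => // ->.
Qed.

(** Boxes form a pi-system generating the Borel sets of tuples, so two
measures that agree on boxes and are finite on the cubes exhausting the space
coincide. One of them is a pushforward here because all the invariance
statements below, and the law of the sample, compare a measure with a
pushforward. *)
Lemma tuple_pushforward_unique d (T : measurableType d) N
    (m : {measure set T -> \bar R}) (f : T -> N.-tuple mR)
    (m' : {measure set (N.-tuple mR) -> \bar R}) :
  measurable_fun setT f ->
  (forall k : nat, m' (box (fun=> [set` `]- k%:R, k%:R[%R])) < +oo)%E ->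
  (forall B, (forall i, measurable (B i)) -> m' (box B) = m (f @^-1` box B)) ->
  forall A, measurable A -> m' A = m (f @^-1` A).
Proof.
move=> mf m'oo m'B A mA.
have -> : m (f @^-1` A) = pushforward m f A by [].
apply: (measure_unique _ _ (@measurable_tuple_boxes N) _ _ _ m' _ _ m'oo) => //.
- move=> _ _ [B mB <-] [C mC <-]; rewrite boxI.
  by exists (fun i => B i `&` C i) => // i; exact: measurableI.
- by move=> k; exists (fun=> [set` `]- k%:R, k%:R[%R]).
- rewrite -subTset => t _.
  exists (\max_(i < N) Num.bound `|tnth t i|)%N => // i /=.
  rewrite in_itv/= -ltr_norml (lt_le_trans (archi_boundP _))//.
  by rewrite ler_nat (@leq_bigmax _ (fun i => Num.bound `|tnth t i|)).
- by move=> _ [B mB <-]; rewrite m'B.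
Qed.

Lemma lebesgue_tuple_invariant N (f : N.-tuple mR -> N.-tuple mR) :
  measurable_fun setT f ->
  (forall B, (forall i, measurable (B i)) ->
    lebesgue_tuple R N (f @^-1` box B) =
    (\prod_(i < N) lebesgue_measure (B i))%E) ->
  forall A, measurable A ->
    lebesgue_tuple R N (f @^-1` A) = lebesgue_tuple R N A.
Proof.
move=> mf fB A mA; apply/esym/tuple_pushforward_unique => //.
  move=> k; rewrite -[X in (X < _)%E]/(lebesgue_tuple R N _).
  rewrite lebesgue_tuple_box// ltey_eq prode_fin_num// => i _.
  by rewrite lebesgue_measure_itv/=; case: ifP.
by move=> B mB; apply: etrans (lebesgue_tuple_box mB) _; rewrite -fB.
Qed.

Lemma lebesgue_measure_translation (c : R) (B : set mR) : measurable B ->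
  lebesgue_measure ((+%R c : mR -> mR) @^-1` B) = lebesgue_measure B.
Proof.
move=> mB.
have mc : measurable_fun setT (+%R c : mR -> mR) by exact: measurable_funD.
apply/esym; apply: (@lebesgue_measure_unique R
  (pushforward lebesgue_measure (+%R c : mR -> mR))) => // _ [[a b] _ <-].
rewrite /= /pushforward (_ : _ @^-1` _ = [set` `]a - c, b - c]%R]); last first.
  by apply/seteqP; split => x /=; rewrite !in_itv/= ltrBlDl lerBrDl.
rewrite !lebesgue_measure_itv/= !lte_fin ltrD2r.
by rewrite -EFinB -EFinD opprB addrA subrK.
Qed.

Definition translate_tuple N (c : R) (t : N.-tuple mR) : N.-tuple mR :=
  [tuple c + tnth t i | i < N].

Lemma measurable_translate_tuple N c :
  measurable_fun setT (@translate_tuple N c).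
Proof.
apply/measurable_fun_tnthP => i.
rewrite (_ : _ \o _ = fun t => c + tnth t i); last first.
  by apply/funext => t /=; rewrite tnth_mktuple.
by apply: measurable_funD => //; exact: measurable_tnth.
Qed.

Lemma lebesgue_tuple_translation N c (A : set (N.-tuple mR)) : measurable A ->
  lebesgue_tuple R N (translate_tuple c @^-1` A) = lebesgue_tuple R N A.
Proof.
apply: lebesgue_tuple_invariant; first exact: measurable_translate_tuple.
move=> B mB.
have mc : measurable_fun setT (+%R c : mR -> mR) by exact: measurable_funD.
rewrite (_ : _ @^-1` _ = box (fun i => (+%R c : mR -> mR) @^-1` B i)).
  2: by apply/seteqP; split => t tB i; have := tB i; rewrite tnth_mktuple.
rewrite lebesgue_tuple_box.
  by apply: eq_bigr => i _; exact: lebesgue_measure_translation.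
by move=> i; rewrite -[X in measurable X]setTI; exact: mc.
Qed.

Definition perm_tuple N (s : 'S_N) (t : N.-tuple mR) : N.-tuple mR :=
  [tuple tnth t (s i) | i < N].

Lemma measurable_perm_tuple N (s : 'S_N) : measurable_fun setT (perm_tuple s).
Proof.
apply/measurable_fun_tnthP => i.
rewrite (_ : _ \o _ = fun t => tnth t (s i)); first exact: measurable_tnth.
by apply/funext => t /=; rewrite tnth_mktuple.
Qed.

Lemma lebesgue_tuple_perm N (s : 'S_N) (A : set (N.-tuple mR)) : measurable A ->
  lebesgue_tuple R N (perm_tuple s @^-1` A) = lebesgue_tuple R N A.
Proof.
apply: lebesgue_tuple_invariant; first exact: measurable_perm_tuple.
move=> B mB.
rewrite (_ : _ @^-1` _ = box (fun i => B ((s^-1)%g i))); last first.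
  apply/seteqP; split => t tB i.
    by have := tB ((s^-1)%g i); rewrite tnth_mktuple permKV.
  by have := tB (s i); rewrite tnth_mktuple permK.
rewrite lebesgue_tuple_box//; apply/esym.
rewrite (reindex_inj (@perm_inj _ (s^-1)%g)) /=.
by apply: eq_bigr => i _.
Qed.

Definition cumsum N (t : N.-tuple mR) : N.-tuple mR :=
  [tuple \sum_(j < N | (j <= i)%N) tnth t j | i < N].

Lemma measurable_cumsum N : measurable_fun setT (@cumsum N).
Proof.
apply/measurable_fun_tnthP => i.
pose F (j : 'I_N) (t : N.-tuple mR) : R := if (j <= i)%N then tnth t j else 0.
rewrite (_ : _ \o _ = fun t => \sum_(j < N) F j t); last first.
  by apply/funext => t /=; rewrite tnth_mktuple big_mkcond.
apply: measurable_sum => j; rewrite /F; case: (j <= i)%N => //.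
exact: measurable_tnth.
Qed.

Lemma tnth_tuple_cons0 N (a : R) (t : N.-tuple mR) :
  tnth (tuple_cons (a, t)) ord0 = a.
Proof. by rewrite (tnth_nth a). Qed.

Lemma tnth_tuple_consS N (a : R) (t : N.-tuple mR) i :
  tnth (tuple_cons (a, t)) (lift ord0 i) = tnth t i.
Proof. by rewrite tnthS. Qed.

Lemma cumsum_cons N (a : R) (t : N.-tuple mR) :
  cumsum (tuple_cons (a, t)) = tuple_cons (a, translate_tuple a (cumsum t)).
Proof.
apply/eq_from_tnth => i.
rewrite tnth_mktuple big_mkcond/= big_ord_recl tnth_tuple_cons0.
case: (unliftP ord0 i) => [j|] ->; last first.
  by rewrite tnth_tuple_cons0 big1 ?addr0.
rewrite tnth_tuple_consS !tnth_mktuple [in RHS]big_mkcond/=.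
congr (_ + _); apply: eq_bigr => k _.
by rewrite tnth_tuple_consS /bump/= !add1n ltnS.
Qed.

(** The map is triangular with ones on the diagonal. By induction on the
length: once the first coordinate [a] is fixed, partial summation acts on the
remaining ones as partial summation followed by the translation by [a], and
Lebesgue measure is the integral over [a] of the measures of the slices. *)
Lemma lebesgue_tuple_cumsum N (A : set (N.-tuple mR)) : measurable A ->
  lebesgue_tuple R N (@cumsum N @^-1` A) = lebesgue_tuple R N A.
Proof.
elim: N A => [|N IH] A mA.
  rewrite (_ : _ @^-1` _ = A)//; apply/seteqP.
  by split=> t /=; rewrite (tuple0 t) (tuple0 (cumsum _)).
rewrite /= /lebesgue_step /pushforward /product_measure1.
apply: eq_integral => a _ /=.
have mAa : measurable [set s | A (tuple_cons (a, s))].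
  rewrite (_ : [set _ | _] = xsection (@tuple_cons R N @^-1` A) a).
    apply: measurable_xsection; rewrite -[X in measurable X]setTI.
    exact: measurable_tuple_cons.
  by apply/seteqP; split => s /=; rewrite /xsection/= inE.
transitivity (lebesgue_tuple R N [set s | A (tuple_cons (a, s))]).
  rewrite -[RHS](lebesgue_tuple_translation a)// -[RHS]IH//.
    congr (_ _); apply/seteqP.
    by split => s; rewrite /xsection/= inE/= cumsum_cons.
  rewrite -[X in measurable X]setTI.
  exact: measurable_translate_tuple.
by congr (_ _); apply/seteqP; split => s; rewrite /xsection/= inE.
Qed.

End boxes.

Arguments translate_tuple {R N} c t.
Arguments perm_tuple {R N} s t.
Arguments cumsum {R N} t.

(** * Quantiles and the law of an independent sample *)

Section quantile.
Context d (T : measurableType d) (R : realType) (P : probability T R).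
Variable Z : {RV P >-> R}.
Let mR := measurableTypeR R.

(** Outside the open unit interval 0 is only a default value: there the set of
[x] may be empty or unbounded from below. *)
Definition quantile (u : R) : R :=
  if 0 < u < 1 then inf [set x | (u%:E <= cdf Z x)%E] else 0.

(** The Galois connection between the quantile function and the distribution
function. From left to right it is right-continuity of the latter; everything
below about quantiles follows from it. *)
Lemma quantile_le u x : 0 < u < 1 -> (quantile u <= x) = (u%:E <= cdf Z x)%E.
Proof.
move=> u01; rewrite /quantile u01; set S := [set _ | _].
have /andP[u0 u1] := u01.
have S0 : S !=set0.
  have u1E : (u%:E < 1 :> \bar R)%E by rewrite lte_fin.
  have /filter_ex[y /ltW uy] : \forall y \near +oo, (u%:E < cdf Z y)%E.
    exact: (@cvg_cdfy1 _ _ _ _ Z _ (open_ereal_gt' u1E)).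
  by exists y.
have lS : has_lbound S.
  have u0E : (0 < u%:E :> \bar R)%E by rewrite lte_fin.
  have /filter_ex[y yu] : \forall y \near -oo, (cdf Z y < u%:E)%E.
    exact: (@cvg_cdfNy0 _ _ _ _ Z _ (open_ereal_lt' u0E)).
  exists y => z Sz.
  rewrite leNgt; apply/negP => /ltW zy.
  have := le_lt_trans (le_trans Sz (cdf_nondecreasing Z zy)) yu.
  by rewrite ltxx.
apply/idP/idP => [Sx|xS]; last exact: ge_inf.
apply: cvge_ge (@cdf_right_continuous _ _ _ _ Z x).
near=> y.
have [z Sz zy] : exists2 z, S z & z < y.
  by apply: inf_lt => //; exact: le_lt_trans Sx _.
by apply: le_trans Sz _; exact/cdf_nondecreasing/ltW.
Unshelve. all: by end_near. Qed.

Lemma measurable_quantile : measurable_fun setT (quantile : mR -> R).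
Proof.
apply: (measurability _ (@RGenOInfty.measurableE R)) => // _ [_ [x ->] <-].
rewrite setTI [X in measurable X](_ : _ =
    (`]0, 1[ `\` [set u | u%:E <= cdf Z x]%E) `|`
    (~` `]0, 1[ `&` [set _ | x < 0])); last first.
  apply/seteqP; split => u /=; rewrite !in_itv/= andbT.
    have [u01|/negP u01] := boolP (0 < u < 1).
      by rewrite ltNge quantile_le// => /negP; left.
    move=> xu; right; split=> //; move: xu.
    by rewrite /quantile (negbTE (introN idP u01)).
  move=> [[u01]|[u01 x0]].
    by rewrite ltNge quantile_le// => /negP.
  by rewrite /quantile (negbTE (introN idP u01)).
have mF : measurable [set u : mR | u%:E <= cdf Z x]%E.
  rewrite (_ : [set _ | _] = [set` `]-oo, fine (cdf Z x)]%R])//.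
  by apply/seteqP; split => u /=;
    rewrite in_itv/= -[cdf Z x]fineK ?fin_num_measure// ?lee_fin.
apply: measurableU; first exact: measurableD.
apply: measurableI; first exact: measurableC.
have [x0|x0] := boolP (x < 0).
  by rewrite (_ : [set _ | _] = setT)//; apply/seteqP; split.
by rewrite (_ : [set _ | _] = set0)//; apply/seteqP; split.
Qed.

(** Inverse transform sampling: it is enough to compare both laws on the half-
lines [(x, +oo)], where by [quantile_le] the left-hand side is the length of
the interval from [F x] to 1, for [F] the distribution function. *)
Lemma lebesgue_quantile (B : set R) : measurable B ->
  lebesgue_measure (quantile @^-1` B `&` `]0, 1[) = distribution P Z B.
Proof.
move=> mB; apply/esym.
have mI : measurable (`]0, 1[%classic : set mR) by exact: measurable_itv.
have mq := measurable_quantile.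
have -> : lebesgue_measure (quantile @^-1` B `&` `]0, 1[) =
  pushforward (mrestr lebesgue_measure mI) (quantile : mR -> R) B by [].
apply: (measure_unique (@RGenOInfty.G R)
  (fun k => [set` `]- k%:R, +oo[%R])) => //.
- exact: RGenOInfty.measurableE.
- move=> _ _ [x ->] [y ->]; exists (Num.max x y).
  by apply/seteqP; split => z /=; rewrite !in_itv/= !andbT gt_max => /andP.
- by move=> k; exists (- k%:R).
- rewrite -subTset => x _; exists (Num.bound `|x|) => //=.
  rewrite in_itv/= andbT ltrNl (le_lt_trans (ler_norm _))// normrN.
  by rewrite (le_lt_trans _ (archi_boundP _))// normr_id.
- move=> _ [x ->]; rewrite /= /pushforward /mrestr.
  pose F := fine (cdf Z x).
  have FE : cdf Z x = F%:E by rewrite fineK ?fin_num_measure.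
  rewrite (_ : quantile @^-1` _ `&` _ = [set` `]F, 1[%R]); last first.
    apply/seteqP; split => u /=; rewrite !in_itv/= andbT.
      by move=> [+ u01]; rewrite ltNge quantile_le// FE lee_fin -ltNge => ->;
        case/andP: u01.
    move=> /andP[Fu u1].
    have u01 : 0 < u < 1 by rewrite u1 andbT (le_lt_trans _ Fu)// fine_ge0.
    by rewrite ltNge quantile_le// FE lee_fin -ltNge.
  rewrite lebesgue_measure_itv/= lte_fin.
  have PE : distribution P Z `]x, +oo[ = (1 - F%:E)%E.
    by rewrite -setCitvl probability_setC// -FE.
  apply: (etrans PE).
  case: ltP => // F1; rewrite (_ : F = 1) ?subee//.
  by apply/eqP; rewrite eq_le F1 andbT -lee_fin -FE cdf_le1.
- by move=> k; rewrite -ge0_fin_numE ?fin_num_measure.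
Qed.

End quantile.

Section sample_law.
Context d (T : measurableType d) (R : realType) (P : probability T R).
Variables (Z : {RV P >-> R}) (N : nat) (Zs : 'I_N -> {RV P >-> R}).
Hypothesis Zs_independent : mutually_independent Zs.
Hypothesis Zs_distribution : forall i, same_distribution (Zs i) Z.
Let mR := measurableTypeR R.

Definition sample_tuple (w : T) : N.-tuple mR := [tuple Zs i w | i < N].

Definition quantile_tuple (u : N.-tuple mR) : N.-tuple mR :=
  [tuple quantile Z (tnth u i) | i < N].

Definition unit_cube : set (N.-tuple mR) := box (fun=> [set` `]0, 1[%R]).

Lemma measurable_sample_tuple : measurable_fun setT sample_tuple.
Proof.
apply/measurable_fun_tnthP => i.
rewrite (_ : _ \o _ = (Zs i : T -> R)); last first.
  by apply/funext => w /=; rewrite tnth_mktuple.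
exact: (@measurable_funPT _ _ _ _ (Zs i)).
Qed.

Lemma measurable_quantile_tuple : measurable_fun setT quantile_tuple.
Proof.
apply/measurable_fun_tnthP => i.
rewrite (_ : _ \o _ = quantile Z \o (fun u => tnth u i)).
  by apply: (measurableT_comp (measurable_quantile Z)); exact: measurable_tnth.
by apply/funext => w /=; rewrite tnth_mktuple.
Qed.

Lemma measurable_unit_cube : measurable unit_cube.
Proof. by apply: measurable_box => i; exact: measurable_itv. Qed.

(** The coupling of the sample with independent uniform variables.
Independence and [lebesgue_quantile] give the equality on boxes. *)
Lemma sample_law (A : set (N.-tuple mR)) : measurable A ->
  P (sample_tuple @^-1` A) =
  lebesgue_tuple R N (quantile_tuple @^-1` A `&` unit_cube).
Proof.
move=> mA.
have ms := measurable_sample_tuple.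
have -> : P (sample_tuple @^-1` A) = pushforward P sample_tuple A by [].
apply: (tuple_pushforward_unique
  (m := mrestr (lebesgue_tuple R N) measurable_unit_cube)
  (f := quantile_tuple)) => //.
- exact: measurable_quantile_tuple.
- move=> k; apply: (@le_lt_trans _ _ 1%E); last exact: ltry.
  apply: probability_le1; rewrite -[X in measurable X]setTI; apply: ms => //.
  by apply: measurable_box => i; exact: measurable_itv.
- move=> B mB; rewrite /= /pushforward /mrestr.
  rewrite (_ : quantile_tuple @^-1` _ `&` _ =
      box (fun i => (quantile Z : mR -> R) @^-1` B i `&` `]0, 1[)); last first.
    apply/seteqP; split => u.
      move=> [uB u01] i; split; last exact: u01.
      by have := uB i; rewrite tnth_mktuple.
    by move=> uB; split => i; have [] := uB i; rewrite ?tnth_mktuple.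
  rewrite lebesgue_tuple_box; last first.
    move=> i; apply: measurableI; last exact: measurable_itv.
    by rewrite -[X in measurable X]setTI;
      exact: (measurable_quantile Z measurableT (mB i)).
  have := Zs_independent [set: 'I_N]%SET mB.
  rewrite (_ : \bigcap_(i in _) _ = sample_tuple @^-1` box B); last first.
    apply/seteqP; split => w wB i.
      by rewrite tnth_mktuple; apply: wB => /=; rewrite inE.
    by move=> _; have := wB i; rewrite tnth_mktuple.
  move=> ->; apply: eq_big => i; first by rewrite inE.
  move=> _; apply/esym/(etrans (lebesgue_quantile Z (mB i)))/esym.
  exact: (Zs_distribution i (mB i)).
Qed.

End sample_law.

Arguments quantile_tuple {d T R P} Z {N} u.
Arguments unit_cube {R N} _.
Arguments sample_tuple {d T R P N} Zs w.

(** * Bounding the expectation by a step function *)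

Section stepwise_bound.
Context d (T : measurableType d) (R : realType) (P : probability T R).

(** Positive and negative parts are compared separately because the
expectation of [X] may be [-oo]. *)
Lemma ae_le_expectation (X Y : T -> R) :
  measurable_fun setT X -> measurable_fun setT Y ->
  {ae P, forall w, X w <= Y w} -> ('E_P[X] <= 'E_P[Y])%E.
Proof.
move=> mX mY XY; rewrite unlock integralE [leRHS]integralE.
have {}mX : measurable_fun setT (fun w => (X w)%:E) by exact/measurable_EFinP.
have {}mY : measurable_fun setT (fun w => (Y w)%:E) by exact/measurable_EFinP.
apply: leeB; apply: ae_ge0_le_integral => //.
- exact: measurable_funepos.
- exact: measurable_funepos.
- apply: filterS XY => w XYw _.
  by rewrite !funeposE ge_max !le_max lexx orbT andbT lee_fin XYw.
- exact: measurable_funeneg.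
- exact: measurable_funeneg.
- apply: filterS XY => w XYw _.
  by rewrite !funenegE ge_max !le_max lexx orbT andbT lee_fin lerN2 XYw.
Qed.

Variable Z : {RV P >-> R}.

Lemma stepwise_nondecreasing (x : nat -> R) N k :
  (forall k, (k < N)%N -> x k <= x k.+1) -> (k <= N)%N -> x k <= x N.
Proof.
elim: N => [|N IH] xS; first by rewrite leqn0 => /eqP ->.
rewrite leq_eqVlt => /predU1P[->//|]; rewrite ltnS => kN.
by apply: le_trans (xS _ _) => //; apply: IH => // j /ltnW; exact: xS.
Qed.

(** If [x j] is the first of the values that is at least [z], the sum
telescopes and the right-hand side is [x j]. *)
Lemma step_majorant (x : nat -> R) N z :
  (forall k, (k < N)%N -> x k <= x k.+1) -> z <= x N ->
  z <= x N - \sum_(k < N) (x k.+1 - x k) * (z <= x k)%R%:R.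
Proof.
elim: N => [|N IH] xS zx; first by rewrite big_ord0 subr0.
rewrite big_ord_recr/=; have [zN|zN] := lerP z (x N).
  have := IH (fun k kN => xS k (ltnW kN)) zN.
  by rewrite mulr1; lra.
rewrite mulr0 addr0 big1 ?subr0// => k _.
have kN : x k <= x N.
  by apply: stepwise_nondecreasing (ltnW (ltn_ord k)) => j /ltnW; exact: xS.
by rewrite lt_geF ?mulr0// (le_lt_trans kN).
Qed.

Lemma expectation_step (x : nat -> R) N :
  (forall k, (k < N)%N -> x k <= x k.+1) -> {ae P, forall w, Z w <= x N} ->
  ('E_P[Z] <=
   (x N - \sum_(k < N) (x k.+1 - x k) * fine (cdf Z (x k)))%:E)%E.
Proof.
move=> xS Zx.
pose A k := Z @^-1` `]-oo, x k].
have mA k : measurable (A k).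
  by rewrite -[X in measurable X]setTI; exact: measurable_funPT.
pose G (k : nat) (w : T) : R := (x k.+1 - x k) * \1_(A k) w.
have iG k : P.-integrable setT (fun w => (G k w)%:E).
  rewrite /G; under eq_fun do rewrite EFinM.
  by apply: integrableZl => //; exact: integrable_indic.
have iS : P.-integrable setT (fun w => (\sum_(k < N) G k w)%:E).
  by under eq_fun do rewrite -sumEFin; exact: integrable_sum.
have mS : measurable_fun setT (fun w => \sum_(k < N) G k w).
  by apply: measurable_sum => k; have /measurable_int/measurable_EFinP := iG k.
pose g (w : T) : R := x N - \sum_(k < N) G k w.
apply: (@le_trans _ _ ('E_P[g])%E).
  apply: ae_le_expectation => //.
    by apply: measurable_funB.
  apply: filterS Zx => w /(step_majorant xS) => /le_trans; apply.
  rewrite /g lerD2l lerN2; apply: ler_sum => k _; rewrite /G indicE.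
  rewrite (_ : (w \in A k) = (Z w <= x k))//.
  by apply/idP/idP; rewrite inE /A/= in_itv.
rewrite unlock /g; under eq_integral do rewrite EFinB.
rewrite integralB_EFin//; last exact: finite_measure_integrable_cst.
have -> : (\int[P]_w (x N)%:E)%E = (x N)%:E.
  by rewrite -[RHS](expectation_cst P) unlock.
rewrite EFinB leeB//.
under [leRHS]eq_integral do rewrite -sumEFin.
rewrite integral_sum// -sumEFin lee_sum// => k _.
rewrite /G; under eq_integral do rewrite EFinM.
rewrite integralZl//; last exact: integrable_indic.
by rewrite integral_indic// setIT EFinM fineK// fin_num_measure.
Qed.

Lemma abel_sum (a x : nat -> R) N :
  \sum_(i < N.+1) a i * x i =
  (\sum_(i < N.+1) a i) * x N -
  \sum_(k < N) (x k.+1 - x k) * \sum_(i < k.+1) a i.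
Proof.
elim: N => [|N IH]; first by rewrite !big_ord1 big_ord0 subr0.
rewrite big_ord_recr/= IH.
rewrite [X in _ = X * _ - _]big_ord_recr [X in _ = _ - X]big_ord_recr /=.
ring.
Qed.

End stepwise_bound.

(** * The bound obtained from the spacings of a sorted sample *)

Section extend_last_theory.
Context (T : Type) (N : nat) (f : 'I_N -> T) (l : T).

Lemma extend_last_widen (i : 'I_N) :
  extend_last (n := N.+1) f l (widen_ord (leqnSn N) i) = f i.
Proof.
rewrite /extend_last /= insubT//= => iN; congr f; exact: val_inj.
Qed.

Lemma extend_last_max : extend_last (n := N.+1) f l ord_max = l.
Proof. by rewrite /extend_last insubF//= ltnn. Qed.

End extend_last_theory.

Section essential_supremum.
Context d (T : measurableType d) (R : realType) (P : probability T R).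
Variable Z : {RV P >-> R}.
Hypothesis Z_bounded : (ess_sup P (EFin \o Z) < +oo)%E.
Let z_last : R := fine (ess_sup P (EFin \o Z)).

Lemma ae_le_ess_sup : {ae P, forall w, Z w <= z_last}.
Proof.
have Zoo : (ess_sup P (EFin \o Z) \is a fin_num)%E.
  rewrite fin_numE -ltey Z_bounded andbT; apply/eqP => ZNy.
  have : P setT = 0%E.
    have /negligibleP : P.-negligible [set: T]; last exact.
    apply: negligibleS (ess_sup_ge P (EFin \o Z)) => w _ /=.
    by rewrite ZNy leeNy_eq.
  by move/eqP; rewrite probability_setT eqe oner_eq0.
apply: filterS (ess_sup_ge P (EFin \o Z)) => w /=.
by rewrite -[ess_sup _ _]fineK.
Qed.

Lemma cdf_ess_sup : cdf Z z_last = 1%E.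
Proof.
rewrite cdf_1_ccdf (_ : ccdf Z z_last = 0%E) ?sube0//.
have mZ : measurable_fun setT (EFin \o Z) by exact/measurable_EFinP.
have /(ae_le_measureP _ z_last%:E mZ) :
    {ae P, forall w, (Z w)%:E <= z_last%:E}%E.
  by apply: filterS ae_le_ess_sup => w; rewrite lee_fin.
by move=> <-; congr (P _).
Qed.

Lemma quantile_le_ess_sup u : 0 < u < 1 -> quantile Z u <= z_last.
Proof.
by move=> u01; rewrite quantile_le// cdf_ess_sup lee_fin ltW//; case/andP: u01.
Qed.

Lemma quantile_nondecreasing u v : 0 < u < 1 -> 0 < v < 1 -> u <= v ->
  quantile Z u <= quantile Z v.
Proof.
move=> u01 v01 uv; rewrite quantile_le//.
by rewrite (le_trans _ (_ : v%:E <= _)%E) ?lee_fin// -quantile_le.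
Qed.

Let mR := measurableTypeR R.

(** Partial sums turn the chart coordinates, which are spacings, into the
ordered sample of uniform variables. *)
Lemma chart_partial_sum N (t : N.-tuple mR) (k : 'I_N) :
  \sum_(i < N.+1 | (i < k.+1)%N) hyperplane_chart (n := N.+1) t 0 i =
  tnth (cumsum t) k.
Proof.
rewrite tnth_mktuple big_mkcond big_ord_recr/= ltnNge ltn_ord addr0.
rewrite [RHS]big_mkcond; apply: eq_bigr => i _.
by rewrite mxE extend_last_widen.
Qed.

(** The deterministic heart of the argument. With [u = cumsum t], [x_k = Q
(u_k)] and last value [x_N = ess sup Z], both sides are of the form [x_N -
\sum_k (x_{k+1} - x_k) c_k]: on the left (as an upper bound) [c_k] is the
distribution function at [x_k], which is at least [u_k] by [quantile_le]; on
the right, after Abel summation, [c_k] is the [k]-th partial sum of [a], which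
is at most [u_k] because the partial sums of [m] are nonnegative. *)
Lemma spacing_bound N (t : N.-tuple mR) (a m : 'rV[R]_N.+1) :
  hyperplane_chart (n := N.+1) t = a + m ->
  simplex R N.+1 a -> coneM R N.+1 m -> unit_cube (cumsum t) ->
  (forall i j : 'I_N, (i <= j)%N -> tnth (cumsum t) i <= tnth (cumsum t) j) ->
  ('E_P[Z] <= (\sum_(i < N.+1) a 0 i * extend_last (n := N.+1)
     (tnth (quantile_tuple Z (cumsum t))) z_last i)%:E)%E.
Proof.
move=> tam [a1 _] [mpos _] u01 uS.
set X := extend_last _ _.
pose x k := X (inord k).
have x_lt (i : 'I_N) : x i = quantile Z (tnth (cumsum t) i).
  have -> : x i = X (widen_ord (leqnSn N) i).
    by congr X; apply: val_inj; rewrite /= inordK// ltnS ltnW.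
  by rewrite /X extend_last_widen tnth_mktuple.
have xN : x N = z_last.
  have -> : x N = X ord_max by congr X; apply: val_inj; rewrite /= inordK.
  by rewrite /X extend_last_max.
have u01i (i : 'I_N) : 0 < tnth (cumsum t) i < 1.
  by have := u01 i; rewrite /= in_itv.
have xS k : (k < N)%N -> x k <= x k.+1.
  move=> kN; rewrite (x_lt (Ordinal kN)).
  have [k1N|] := ltnP k.+1 N.
    by rewrite (x_lt (Ordinal k1N)) quantile_nondecreasing// uS /=.
  move=> Nk; have -> : k.+1 = N by apply/eqP; rewrite eqn_leq kN.
  by rewrite xN quantile_le_ess_sup.
apply: le_trans (expectation_step xS _) _.
  by rewrite xN; exact: ae_le_ess_sup.
pose al k := a 0 (inord k).
have -> : \sum_(i < N.+1) a 0 i * X i = \sum_(i < N.+1) al i * x i.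
  by apply: eq_bigr => i _; rewrite /al /x inord_val.
have al1 : \sum_(i < N.+1) al i = 1.
  by rewrite -a1; apply: eq_bigr => i _; rewrite /al inord_val.
rewrite abel_sum al1 mul1r lee_fin lerD2l lerN2; apply: ler_sum => k _.
apply: ler_wpM2l; first by rewrite subr_ge0 xS.
have -> : \sum_(i < k.+1) al i = \sum_(i < N.+1 | (i < k.+1)%N) a 0 i.
  rewrite (big_ord_widen N.+1 al) ?ltnS 1?ltnW//.
  by apply: eq_bigr => i _; rewrite /al inord_val.
(* partial sum of a <= partial sum of a + m = u_k <= F (Q (u_k)) *)
apply: (@le_trans _ _ (tnth (cumsum t) k)).
  rewrite -chart_partial_sum tam; under [leRHS]eq_bigr do rewrite mxE.
  by rewrite big_split/= lerDl mpos//= ltn_ord.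
rewrite -lee_fin fineK ?fin_num_measure//.
by rewrite -quantile_le// x_lt.
Qed.

End essential_supremum.

(** * The largest weighted mean as a function of the sample, and sorting *)

Section best_mean.
Context {R : realType} (N : nat) (A : set 'rV[R]_N.+1) (z_last : R).
Hypothesis A_simplex : A `<=` simplex R N.+1.
Let mR := measurableTypeR R.

Definition best_mean (z : N.-tuple mR) : \bar R :=
  ereal_sup [set (\sum_(i < N.+1) mu 0 i *
    extend_last (n := N.+1) (tnth z) z_last i)%:E | mu in A].

Lemma best_mean_le (y z : N.-tuple mR) :
  (forall i, tnth y i <= tnth z i) -> (best_mean y <= best_mean z)%E.
Proof.
move=> yz; apply/ge_ereal_sup => _ [mu Amu <-].
apply: le_trans (ereal_sup_ubound _); last by exists mu.
rewrite lee_fin; apply: ler_sum => i _.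
apply: ler_wpM2l; first by have [_] := A_simplex Amu; exact.
by rewrite /extend_last; case: insubP.
Qed.

(** Lowering every sample value by at most [e] lowers a weighted mean by at
most [e], as the weights are nonnegative and sum to 1. *)
Lemma best_mean_gt_rat r (z : N.-tuple mR) : (r%:E < best_mean z)%E ->
  exists2 q : N.-tuple rat, (forall i, ratr (tnth q i) <= tnth z i) &
    (r%:E < best_mean [tuple ratr (tnth q i) | i < N])%E.
Proof.
move=> /ereal_sup_gt[_ [mu Amu <-]]; rewrite lte_fin.
set S := \sum_(i < _) _ => rS.
have [mu1 mu0] := A_simplex Amu.
pose e := (S - r) / 2.
have e0 : 0 < e by rewrite divr_gt0// subr_gt0.
have zq i : exists q : rat, tnth z i - e < ratr q < tnth z i.
  have : tnth z i - e < tnth z i by rewrite ltrBlDr ltrDl.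
  by move=> /rat_in_itvoo[q]; rewrite in_itv/=; exists q.
have [q Hq] := choice zq.
exists [tuple q i | i < N].
  by move=> i; rewrite tnth_mktuple; case/andP: (Hq i) => _ /ltW.
apply: lt_le_trans (ereal_sup_ubound _); last by exists mu.
rewrite lte_fin; apply: (@lt_le_trans _ _ (S - e)); first by rewrite /e; lra.
rewrite lerBlDr -lerBlDl -sumrB -[leRHS]mul1r -mu1 mulr_suml.
apply: ler_sum => i _; rewrite -mulrBr ler_wpM2l//.
rewrite /extend_last; case: insubP => [j _ _|_]; last by rewrite subrr ltW.
by rewrite !tnth_mktuple lerBlDr addrC -lerBlDr; case/andP: (Hq j) => /ltW.
Qed.

(** The function is nondecreasing in each coordinate, so by [best_mean_gt_rat]
each set [best_mean > r] is a countable union of orthants with rational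
corners. *)
Lemma measurable_best_mean : measurable_fun setT best_mean.
Proof.
apply: (measurability _ (@ErealGenOInfty.measurableE R)) => // _ [_ [r ->] <-].
pose F (q : N.-tuple rat) : set (N.-tuple mR) :=
  if (r%:E < best_mean [tuple ratr (tnth q i) | i < N])%E
  then box (fun i => [set` `[ratr (tnth q i), +oo[%R]) else set0.
rewrite setTI (_ : _ @^-1` _ = \bigcup_q F q).
  apply: countable_bigcupT_measurable => // q.
  by rewrite /F; case: ifP => // _; apply: measurable_box => i.
apply/seteqP; split=> z /=; rewrite in_itv/= andbT.
  move=> /best_mean_gt_rat[q qz rq]; exists q => //.
  by rewrite /F rq => i /=; rewrite in_itv/= andbT.
move=> [q _]; rewrite /F; case: ifP => // rq zq.
apply: lt_le_trans rq _; apply: best_mean_le => i.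
by have := zq i; rewrite tnth_mktuple /= in_itv/= andbT.
Qed.

Hypothesis A_perm : permutation_invariant A.

(** A permutation of the sample, extended so as to fix the last index, is
absorbed by the inverse permutation of the weights. *)
Lemma best_mean_perm (s : 'S_N) (z : N.-tuple mR) :
  (best_mean (perm_tuple s z) <= best_mean z)%E.
Proof.
apply/ge_ereal_sup => _ [mu Amu <-].
pose sg := lift_perm ord_max ord_max s.
apply: ereal_sup_ubound.
exists (\row_i mu 0 ((sg^-1)%g i)); first exact: A_perm.
congr EFin; rewrite (reindex_inj (@perm_inj _ sg)); apply: eq_bigr => i _.
rewrite mxE permK; congr (_ * _); rewrite /sg.
case: (unliftP ord_max i) => [j|] ->.
  2: by rewrite lift_perm_id !extend_last_max.
rewrite lift_perm_lift.
have liftE (k : 'I_N) : lift ord_max k = widen_ord (leqnSn N) k.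
  by apply: val_inj; rewrite /= /bump leqNgt ltn_ord.
by rewrite !liftE !extend_last_widen tnth_mktuple.
Qed.

End best_mean.

Section chambers.
Context {R : realType} (N : nat).
Let mR := measurableTypeR R.
Local Notation leb := (lebesgue_tuple R N).
Implicit Types u t : N.-tuple mR.

Definition chamber : set (N.-tuple mR) :=
  [set u | forall i j : 'I_N, (i <= j)%N -> tnth u i <= tnth u j].

Definition open_chamber : set (N.-tuple mR) :=
  [set u | forall i j : 'I_N, (i < j)%N -> tnth u i < tnth u j].

Lemma measurable_chamber : measurable chamber.
Proof.
pose F (p : 'I_N * 'I_N) : set (N.-tuple mR) :=
  if (p.1 <= p.2)%N then [set u | tnth u p.1 <= tnth u p.2] else setT.
rewrite (_ : chamber = \bigcap_(p in setT) F p).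
  apply: fin_bigcap_measurable => // -[i j] _; rewrite /F/=; case: ifP => // _.
  rewrite -[X in measurable X]setTI.
  apply: (@measurable_fun_ler _ _ R setT (fun u => tnth u i) (fun u => tnth u j)
    _ _ measurableT [set true]) => //; exact: measurable_tnth.
apply/seteqP; split => u uS.
  by move=> [i j] _; rewrite /F/=; case: ifP => //; exact: uS.
by move=> i j ij; have := uS (i, j) I; rewrite /F/= ij.
Qed.

Lemma measurable_open_chamber : measurable open_chamber.
Proof.
pose F (p : 'I_N * 'I_N) : set (N.-tuple mR) :=
  if (p.1 < p.2)%N then [set u | tnth u p.1 < tnth u p.2] else setT.
rewrite (_ : open_chamber = \bigcap_(p in setT) F p).
  apply: fin_bigcap_measurable => // -[i j] _; rewrite /F/=; case: ifP => // _.
  rewrite -[X in measurable X]setTI.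
  apply: (@measurable_fun_ltr _ _ R setT (fun u => tnth u i) (fun u => tnth u j)
    _ _ measurableT [set true]) => //; exact: measurable_tnth.
apply/seteqP; split => u uS.
  by move=> [i j] _; rewrite /F/=; case: ifP => //; exact: uS.
by move=> i j ij; have := uS (i, j) I; rewrite /F/= ij.
Qed.

Lemma measurable_perm_preimage (s : 'S_N) (A : set (N.-tuple mR)) :
  measurable A -> measurable (perm_tuple s @^-1` A).
Proof.
by move=> mA; rewrite -[X in measurable X]setTI; exact: measurable_perm_tuple.
Qed.

Lemma chamber_cover u : exists s : 'S_N, chamber (perm_tuple s u).
Proof.
have /tuple_permP[s us] : perm_eq (sort <=%R u) u by rewrite perm_sort.
exists s => i j ij.
have Hs : sorted <=%R (perm_tuple s u).
  by rewrite /perm_tuple -us sort_sorted//; exact: le_total.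
rewrite !(tnth_nth 0); apply: (sorted_leq_nth le_trans lexx) => //.
- by rewrite inE size_tuple.
- by rewrite inE size_tuple.
Qed.

(** A tuple that becomes strictly increasing has distinct entries, and its
strictly increasing rearrangement is unique. *)
Lemma open_chamber_inj (s r : 'S_N) u :
  open_chamber (perm_tuple s u) -> open_chamber (perm_tuple r u) -> s = r.
Proof.
move=> us ur.
have sorted_open (v : N.-tuple mR) : open_chamber v -> sorted <%R v.
  move=> vC; apply/(sortedP 0) => i; rewrite size_tuple => iN.
  have := vC (Ordinal (ltnW iN)) (Ordinal iN) (leqnn _).
  by rewrite !(tnth_nth 0).
have usr : perm_tuple s u = perm_tuple r u.
  apply: val_inj; apply: (irr_sorted_eq lt_trans ltxx).
  - exact: sorted_open.
  - exact: sorted_open.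
  - have E (p : 'S_N) : perm_tuple p u =i u.
      have /perm_mem // : perm_eq (perm_tuple p u) u.
      by apply/tuple_permP; exists p.
    by move=> x; rewrite !E.
apply/permP => i; apply/eqP; apply: contraT => sri.
have u_inj (a b : 'I_N) : a != b -> tnth u a != tnth u b.
  rewrite -(permKV s a) -(permKV s b).
  set a' := (s^-1)%g a; set b' := (s^-1)%g b.
  move=> ab; have {}ab : a' != b' by apply: contraNneq ab => ->.
  move: ab; rewrite -val_eqE/= neq_ltn => /orP[] /us;
    by rewrite !tnth_mktuple => /lt_eqF; rewrite 1?eq_sym => ->.
have := u_inj _ _ sri.
have := congr1 (fun v : N.-tuple mR => tnth v i) usr.
by rewrite !tnth_mktuple => ->; rewrite eqxx.
Qed.

End chambers.

Arguments chamber {R N} _.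
Arguments open_chamber {R N} _.

(** * Measures of chambers *)

Section sorting.
Context {R : realType} (N : nat).
Let mR := measurableTypeR R.
Local Notation leb := (lebesgue_tuple R N).

Lemma sum_perm_const (x : \bar R) : x \is a fin_num ->
  (\sum_(s \in [set: 'S_N]) x = N`!%:R%:E * x)%E.
Proof.
move=> xfin; rewrite -card_Sn -(fineK xfin) -EFinM.
rewrite (fsbigE (index_enum 'S_N)) ?index_enum_uniq//; last first.
  by move=> s _; rewrite mem_index_enum.
under eq_bigl do rewrite in_setT.
by rewrite sumEFin sumr_const mulr_natl.
Qed.

Lemma lebesgue_unit_cube : leb unit_cube = 1%E.
Proof.
rewrite lebesgue_tuple_box// big1// => i _.
by rewrite lebesgue_measure_itv/= lte_fin ltr01 oppr0 adde0.
Qed.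

Lemma lebesgue_sub_cube_fin (A : set (N.-tuple mR)) : measurable A ->
  A `<=` unit_cube -> leb A \is a fin_num.
Proof.
move=> mA A01; rewrite ge0_fin_numE//.
have := @measurable_unit_cube R N => mC.
apply: le_lt_trans (ltry 1); rewrite -lebesgue_unit_cube.
by apply: le_measure => //; rewrite inE.
Qed.

(** The [N!] rearrangements of [G] within the open chamber are disjoint,
contained in [G], and have the same measure. *)
Lemma symmetric_chamber_le (G : set (N.-tuple mR)) : measurable G ->
  G `<=` unit_cube -> (forall s : 'S_N, perm_tuple s @^-1` G `<=` G) ->
  (N`!%:R%:E * leb (G `&` open_chamber) <= leb G)%E.
Proof.
move=> mG G01 Gs.
have mGC : measurable (G `&` open_chamber).
  by apply: measurableI => //; exact: measurable_open_chamber.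
rewrite -sum_perm_const; last first.
  by apply: lebesgue_sub_cube_fin => // u [/G01].
have mperm := @measurable_perm_preimage R N.
rewrite (eq_fsbigr
  (fun s : 'S_N => leb (perm_tuple s @^-1` (G `&` open_chamber)))).
  2: by move=> s _; rewrite lebesgue_tuple_perm.
rewrite -measure_fin_bigcup; last 3 first.
- exact: finite_finset.
- apply/trivIsetP => s r _ _ sr; apply/seteqP; split => // u [[_ us] [_ ur]].
  by move: sr; rewrite (open_chamber_inj us ur) eqxx.
- by move=> s _; exact: mperm.
apply: le_measure; rewrite ?inE//.
  apply: fin_bigcup_measurable; first exact: finite_finset.
  by move=> s _; exact: mperm.
by move=> u [s _ [/Gs]].
Qed.

Definition sorted_cube : set (N.-tuple mR) := unit_cube `&` chamber.

Lemma measurable_sorted_cube : measurable sorted_cube.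
Proof.
exact: measurableI (@measurable_unit_cube R N) (@measurable_chamber R N).
Qed.

(** Every tuple can be sorted, so the [N!] images of the sorted cube, which
all have the same measure, cover the unit cube. *)
Lemma sorted_cube_ge : (1 <= N`!%:R%:E * leb sorted_cube)%E.
Proof.
have mC := measurable_sorted_cube.
have mcube := @measurable_unit_cube R N.
have mperm := @measurable_perm_preimage R N.
rewrite -sum_perm_const; last by apply: lebesgue_sub_cube_fin => // u [].
rewrite (eq_fsbigr (fun s : 'S_N => leb (perm_tuple s @^-1` sorted_cube))).
  2: by move=> s _; rewrite lebesgue_tuple_perm.
rewrite -lebesgue_unit_cube; apply: content_sub_fsum => //.
- exact: finite_finset.
- by move=> s _; exact: mperm.
move=> u u01; have [s us] := chamber_cover u.
by exists s => //; split => // i; rewrite tnth_mktuple.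
Qed.

Definition hits (c : R) : set (N.-tuple mR) := [set u | exists i, tnth u i = c].

Lemma hitsE c : hits c =
  \bigcup_(i in [set: 'I_N]) box (fun j => if j == i then [set c] else setT).
Proof.
apply/seteqP; split => u.
  by move=> [i ui]; exists i => // j; case: eqP => // ->.
by move=> [i _ /(_ i)]; rewrite eqxx => ui; exists i.
Qed.

Let measurable_hit c (i j : 'I_N) :
  measurable (if j == i then [set c] else setT : set mR).
Proof. by case: ifP => // _; exact: measurable_set1. Qed.

Lemma measurable_hits c : measurable (hits c).
Proof.
rewrite hitsE; apply: fin_bigcup_measurable => // i _.
by apply: measurable_box => j; exact: measurable_hit.
Qed.

Lemma lebesgue_hits c : leb (hits c) = 0%E.
Proof.
apply/eqP; rewrite -measure_le0.
have mhits := measurable_hits c.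
have mb (i : 'I_N) : measurable (box (fun j : 'I_N =>
    if j == i then [set c] else setT : set mR)).
  by apply: measurable_box => j; exact: measurable_hit.
apply: (le_trans (content_sub_fsum _ _ (fun i _ => mb i) mhits _)).
- exact: finite_finset.
- by rewrite hitsE; exact: subset_refl.
rewrite fsbig1// => i _.
apply: etrans (lebesgue_tuple_box (measurable_hit c i)) _.
by rewrite (bigD1 i)//= eqxx lebesgue_measure_set1 mul0e.
Qed.

Lemma cumsumS (t : N.-tuple mR) (i j : 'I_N) : j = i.+1 :> nat ->
  tnth (cumsum t) j = tnth t j + tnth (cumsum t) i.
Proof.
move=> ji; rewrite !tnth_mktuple (bigD1 j)//=; congr (_ + _).
by apply: eq_bigl => k; rewrite andbC -val_eqE/= -ltn_neqAle ji ltnS.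
Qed.

(** Equal entries of a nondecreasing tuple force two equal neighbours, that
is, a vanishing increment. *)
Lemma chamber_ties (t : N.-tuple mR) : chamber (cumsum t) ->
  open_chamber (cumsum t) \/ hits 0 t.
Proof.
move=> tC; have [[i ti]|no0] := pselect (exists i, tnth t i = 0).
  by right; exists i.
left=> i j ij; rewrite lt_neqAle tC ?(ltnW ij)// andbT.
apply/eqP => uij; apply: no0.
have iN : (i.+1 < N)%N by exact: leq_ltn_trans ij (ltn_ord j).
exists (Ordinal iN).
have : tnth (cumsum t) (Ordinal iN) = tnth (cumsum t) i.
  apply: le_anti; rewrite {1}uij (tC (Ordinal iN) j)//=.
  by rewrite tC/=.
by rewrite (@cumsumS t i)// => /eqP; rewrite -subr_eq0 addrK => /eqP.
Qed.

(** Ties are negligible: pulled back by partial summation, they lie in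
coordinate hyperplanes. *)
Lemma lebesgue_chamber_le (G : set (N.-tuple mR)) : measurable G ->
  (leb (G `&` chamber) <= leb (G `&` open_chamber))%E.
Proof.
move=> mG.
have mo : measurable (G `&` open_chamber).
  by apply: measurableI => //; exact: measurable_open_chamber.
have mc : measurable (G `&` chamber).
  by apply: measurableI => //; exact: measurable_chamber.
have mcum (B : set (N.-tuple mR)) : measurable B ->
    measurable (cumsum @^-1` B).
  by move=> mB; rewrite -[X in measurable X]setTI; exact: measurable_cumsum.
rewrite -lebesgue_tuple_cumsum// -[leRHS]lebesgue_tuple_cumsum//.
have mh := measurable_hits 0.
rewrite -(measureU0 (mcum _ mo) mh (lebesgue_hits 0)).
apply: le_measure; rewrite ?inE//.
- exact: mcum.
- by apply: measurableU => //; exact: mcum.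
- by move=> t [Gt /chamber_ties[]]; [left|right].
Qed.

End sorting.

Arguments sorted_cube {R N} _.
Arguments hits {R N} c.

(** * Comparison with the uniform distribution on the simplex *)

Section spacings.
Context {R : realType} (N : nat).
Let mR := measurableTypeR R.
Implicit Types t : N.-tuple mR.

Lemma simplex_chart t :
  simplex R N.+1 (hyperplane_chart (n := N.+1) t) <->
  (forall i, 0 <= tnth t i) /\ \sum_i tnth t i <= 1.
Proof.
have chart_lt i :
    hyperplane_chart (n := N.+1) t 0 (widen_ord (leqnSn N) i) = tnth t i.
  by rewrite mxE extend_last_widen.
have chart_max : hyperplane_chart (n := N.+1) t 0 ord_max = 1 - \sum_i tnth t i.
  by rewrite mxE extend_last_max.
split=> [[_ t0]|[t0 t1]].
  split=> [i|]; first by rewrite -chart_lt.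
  by rewrite -subr_ge0 -chart_max.
split.
  rewrite big_ord_recr/= chart_max.
  by under eq_bigr do rewrite chart_lt; rewrite subrKC.
move=> i; rewrite mxE /extend_last; case: insubP => [j _ _|_]; first exact: t0.
by rewrite subr_ge0.
Qed.

Lemma cumsum_bounds t : simplex R N.+1 (hyperplane_chart (n := N.+1) t) ->
  chamber (cumsum t) /\ forall i, 0 <= tnth (cumsum t) i <= 1.
Proof.
move=> /simplex_chart[t0 t1]; split=> [i j ij|i]; rewrite !tnth_mktuple.
  rewrite big_mkcond [leRHS]big_mkcond/=; apply: ler_sum => k _.
  case: ifP => [ki|_]; first by rewrite (leq_trans ki ij).
  by case: ifP.
rewrite sumr_ge0//=; apply: le_trans t1; rewrite big_mkcond/=.
by apply: ler_sum => k _; case: ifP.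
Qed.

Lemma chamber_simplex t : unit_cube (cumsum t) -> chamber (cumsum t) ->
  simplex R N.+1 (hyperplane_chart (n := N.+1) t).
Proof.
move=> u01 uS; apply/simplex_chart.
have {}u01 i : 0 < tnth (cumsum t) i < 1 by have := u01 i; rewrite /= in_itv.
split=> [i|].
  case: i => -[|k] kN.
    have := u01 (Ordinal kN); rewrite tnth_mktuple (bigD1 (Ordinal kN))//=.
    rewrite big1 ?addr0 => [/andP[/ltW]//|j].
    by rewrite leqn0 -val_eqE/= => /andP[/eqP ->].
  have := uS (Ordinal (ltnW kN)) (Ordinal kN) (leqnSn k).
  by rewrite (@cumsumS _ _ t (Ordinal (ltnW kN)) (Ordinal kN))// lerDr.
case: N t u01 {uS} => [|M] t u01; first by rewrite big_ord0.
have /andP[_ /ltW] := u01 ord_max; rewrite tnth_mktuple.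
by rewrite (eq_bigl xpredT) => [//|i]; exact: leq_ord.
Qed.

End spacings.

Section main.
Context {R : realType} {N : nat} {A : set 'rV[R]_N.+1}.
Hypothesis A_simplex : A `<=` simplex R N.+1.
Hypothesis A_perm : permutation_invariant A.
Context {d : measure_display} {T : measurableType d} {P : probability T R}.
Context {Z : {RV P >-> R}}.
Hypothesis Z_bounded : (ess_sup P (EFin \o Z) < +oo)%E.
Let mR := measurableTypeR R.
Let z_last : R := fine (ess_sup P (EFin \o Z)).
Local Notation leb := (lebesgue_tuple R N).

(** The samples for which the largest weighted mean bounds the expectation. *)
Definition covered : set (N.-tuple mR) :=
  [set z | ('E_P[Z] <= best_mean A z_last z)%E].

(** The values of the uniform variables that produce, through the quantile
function, a covered sample. *)
Definition covered_ranks : set (N.-tuple mR) :=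
  quantile_tuple Z @^-1` covered `&` unit_cube.

Lemma measurable_covered : measurable covered.
Proof.
rewrite -[X in measurable X]setTI.
apply: emeasurable_fun_c_infty => //.
exact: measurable_best_mean.
Qed.

Lemma measurable_covered_ranks : measurable covered_ranks.
Proof.
apply: measurableI; last exact: measurable_unit_cube.
rewrite -[X in measurable X]setTI.
by apply: measurable_quantile_tuple => //; exact: measurable_covered.
Qed.

Lemma covered_ranks_perm (s : 'S_N) :
  perm_tuple s @^-1` covered_ranks `<=` covered_ranks.
Proof.
move=> u [ucov u01]; split; last first.
  by move=> i; have := u01 ((s^-1)%g i); rewrite tnth_mktuple permKV.
have qs : quantile_tuple Z (perm_tuple s u) = perm_tuple s (quantile_tuple Z u).
  by apply: eq_from_tnth => i; rewrite !tnth_mktuple.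
apply: le_trans ucov _; rewrite qs.
exact: best_mean_perm.
Qed.

Let S := @minkowski_sum R N.+1 A (coneM R N.+1).

(** The points of the closed cube with a coordinate 0 or 1 are set apart
because quantiles are only controlled on the open unit interval. *)
Lemma spacings_covered :
  @hyperplane_chart R N.+1 @^-1` (S `&` simplex R N.+1) `<=`
  @cumsum R N @^-1` ((covered_ranks `&` chamber) `|` (hits 0 `|` hits 1)).
Proof.
move=> t [[a Aa [m Mm amt]] /cumsum_bounds[uS u01]].
have [h0|h0] := pselect (hits 0 (cumsum t)); first by right; left.
have [h1|h1] := pselect (hits 1 (cumsum t)); first by right; right.
have ucube : unit_cube (cumsum t).
  move=> i; rewrite /= in_itv/= !lt_neqAle; have /andP[-> ->] := u01 i.
  rewrite !andbT; apply/andP; split; apply/eqP => ui.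
    by apply: h0; exists i.
  by apply: h1; exists i.
left; split => //; split => //.
apply: le_trans
  (spacing_bound Z_bounded (esym amt) (A_simplex Aa) Mm ucube uS) _.
by apply: ereal_sup_ubound; exists a.
Qed.

(** The set on the left need not be Borel, but by [spacings_covered] it is
contained in a Borel set of the required measure. *)
Lemma spacings_measure_le :
  ((leb^*)%mu (@hyperplane_chart R N.+1 @^-1` (S `&` simplex R N.+1)) <=
   leb (covered_ranks `&` chamber))%E.
Proof.
have mG := measurable_covered_ranks.
have mGc : measurable (covered_ranks `&` chamber).
  by apply: measurableI => //; exact: measurable_chamber.
have mh c := @measurable_hits R N c.
have mU : measurable ((covered_ranks `&` chamber) `|` (hits 0 `|` hits 1)).
  by apply: measurableU => //; exact: measurableU.
apply: le_trans (le_mu_ext _ spacings_covered) _.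
have mcU : measurable
    (@cumsum R N @^-1` ((covered_ranks `&` chamber) `|` (hits 0 `|` hits 1))).
  by rewrite -[X in measurable X]setTI; exact: measurable_cumsum.
rewrite (measurable_mu_extE _ mcU).
rewrite [X in (X <= _)%E](lebesgue_tuple_cumsum mU).
rewrite [X in (X <= _)%E]measureU0//.
  exact: measurableU.
apply: etrans (measureU0 (mh 0) (mh 1) _) _; exact: lebesgue_hits.
Qed.

Lemma simplex_measure_ge :
  (leb sorted_cube <=
   (leb^*)%mu (@hyperplane_chart R N.+1 @^-1` simplex R N.+1))%E.
Proof.
have mC := @measurable_sorted_cube R N.
have mcC : measurable (@cumsum R N @^-1` sorted_cube).
  by rewrite -[X in measurable X]setTI; exact: measurable_cumsum.
rewrite -lebesgue_tuple_cumsum// -[leLHS](measurable_mu_extE _ mcC).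
by apply: le_mu_ext => t [u01 uS]; exact: chamber_simplex.
Qed.

(** The simplex has measure at least [1 / N!] by [sorted_cube_ge], and [N!]
times the part of [covered_ranks] in the chamber is at most its whole measure
by [symmetric_chamber_le], ties being negligible. *)
Lemma uniform_simplex_le : (uniform_simplex S <= leb covered_ranks)%E.
Proof.
have mG := measurable_covered_ranks.
have mC := @measurable_sorted_cube R N.
set V := ((leb^*)%mu (@hyperplane_chart R N.+1 @^-1` (S `&` simplex R N.+1))).
set D := ((leb^*)%mu (@hyperplane_chart R N.+1 @^-1` simplex R N.+1)).
have DV : (D^-1 <= N`!%:R%:E)%E.
  have := @sorted_cube_ge R N.
  have yfin : leb (@sorted_cube R N) \is a fin_num.
    by apply: lebesgue_sub_cube_fin => // u [].
  have := simplex_measure_ge; rewrite -/D; rewrite -(fineK yfin).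
  set y := fine _ => yD; rewrite -EFinM lee_fin => Ky.
  have y0 : 0 < y.
    have : 0 < N`!%:R * y by rewrite (lt_le_trans ltr01).
    by rewrite pmulr_rgt0// ltr0n fact_gt0.
  apply: (@le_trans _ _ (y%:E^-1)%E).
    rewrite lee_pV2// inE/= ?lee_fin ?(ltW y0)//.
    by apply: le_trans yD; rewrite lee_fin ltW.
  by rewrite inver gt_eqF// lee_fin -[leLHS]mul1r ler_pdivrMr.
have leV := spacings_measure_le.
rewrite /uniform_simplex -/V -/D.
apply: (@le_trans _ _ (leb (covered_ranks `&` chamber) * N`!%:R%:E)%E).
  apply: lee_pmul => //; first exact: mu_ext_ge0.
  by rewrite inve_ge0 mu_ext_ge0.
rewrite muleC; apply: le_trans (symmetric_chamber_le mG _ covered_ranks_perm).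
  by apply: lee_pmul => //; exact: lebesgue_chamber_le.
by move=> u [].
Qed.

Lemma uniform_simplex_le_probability (Zs : 'I_N -> {RV P >-> R}) :
  mutually_independent Zs -> (forall i, same_distribution (Zs i) Z) ->
  (uniform_simplex S <= P [set w | 'E_P[Z] <=
    ereal_sup [set (\sum_(i < N.+1) mu 0%R i *
      extend_last (n := N.+1) (fun j => Zs j w) z_last i)%:E | mu in A]])%E.
Proof.
move=> Zind Zdist.
rewrite (_ : [set w | _] = sample_tuple Zs @^-1` covered).
  by rewrite (sample_law Zind Zdist measurable_covered) uniform_simplex_le.
apply/funext => w; rewrite /covered /best_mean /=.
rewrite (_ : tnth _ = fun j => Zs j w)//.
by apply/funext => j; rewrite tnth_mktuple.
Qed.

End main.

Theorem mainTheorem1 (R : realType) (n : nat) (n_ge2 : (2 <= n)%N)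
    (A : set 'rV[R]_n)
    (A_simplex : A `<=` simplex R n)
    (A_measurable : hyperplane_measurable A)
    (A_perm : permutation_invariant A)
    (d : measure_display) (T : measurableType d) (P : probability T R)
    (Z : {RV P >-> R}) (Zs : 'I_n.-1 -> {RV P >-> R})
    (Zs_independent : mutually_independent Zs)
    (Zs_distribution : forall i, same_distribution (Zs i) Z)
    (Z_bounded : (ess_sup P (EFin \o Z) < +oo)%E) :
  let z_last : R := fine (ess_sup P (EFin \o Z)) in
  let sample (w : T) : 'I_n -> R := extend_last (fun j => Zs j w) z_last in
  (P [set w | 'E_P[Z] <=
        ereal_sup [set (\sum_(i < n) mu 0%R i * sample w i)%:E | mu in A]]
   >= uniform_simplex (minkowski_sum A (coneM R n)))%E.
Proof.
case: n n_ge2 A A_simplex A_measurable A_perm Zs Zs_independent Zs_distribution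
  => [//|N] _ A A_simplex _ A_perm Zs Zs_independent Zs_distribution.
exact: uniform_simplex_le_probability.
Qed.
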